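(* Let $d_A,d_R,n$ be positive integers, let $\hat{\sigma}_A$ be a positive semidefinite operator on $\mathbb{C}^{d_A}$, and let $\rho_{A^nR^n}$ be any purification of $(\hat{\sigma}_A)^{\otimes n}$ that is supported on the symmetric subspace $\mathrm{Sym}^n(\mathbb{C}^{d_A}\otimes\mathbb{C}^{d_R})$. Then there exists a probability measure $\mathrm{d}\phi$ on the set of purifications $|\phi\rangle\langle\phi|_{AR}\in\mathbb{C}^{d_A}\otimes\mathbb{C}^{d_R}$ of $\hat{\sigma}_A$ such that $$\rho_{A^nR^n}\leq g_{n,d_Ad_R}\int |\phi\rangle\langle\phi|_{AR}^{\otimes n}\,\mathrm{d}\phi .$$
   Context: For a finite-dimensional Hilbert space $V$, $\mathrm{Sym}^n(V)\subseteq V^{\otimes n}$ denotes the symmetric subspace (vectors invariant under all permutations of the $n$ tensor factors); here $V=\mathbb{C}^{d_A}\otimes\mathbb{C}^{d_R}$ and $(\mathbb{C}^{d_A}\otimes\mathbb{C}^{d_R})^{\otimes n}$ is identified with $A^nR^n$. For positive integers $n,x$, $g_{n,x}:=\dim\mathrm{Sym}^n(\mathbb{C}^x)=\binom{n+x-1}{n}$. A purification of a positive operator $P$ on $A$ is a rank-one positive operator $|\psi\rangle\langle\psi|$ on $A\otimes R$ with $\mathrm{Tr}_R|\psi\rangle\langle\psi|=P$. The operator inequality $\leq$ is in the positive semidefinite order. *)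

(* Defs.v *)
From HB Require Import structures.
From mathcomp Require Import all_boot all_order all_algebra all_fingroup.
From mathcomp Require Import all_classical all_reals all_analysis.
From mathcomp Require Import complex.
Set Implicit Arguments. Unset Strict Implicit. Unset Printing Implicit Defensive.
Import Order.TTheory GRing.Theory Num.Theory.
Local Open Scope ring_scope.

(* An operator on the Hilbert space C^I (I a finite index type) is given by
   its matrix M : I -> I -> C. *)
Section Ops.
Variable R : realType.
Local Notation C := R[i].

Definition psd_op (I : finType) (M : I -> I -> C) : Prop :=
  forall v : I -> C, 0 <= \sum_(i : I) \sum_(j : I) (v i)^* * M i j * v j.

Definition le_op (I : finType) (A B : I -> I -> C) : Prop :=
  psd_op (fun i j => B i j - A i j).

Definition proj_op (I : finType) (v : I -> C) : I -> I -> C :=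
  fun i j => v i * (v j)^*.

(* n-fold tensor power of an operator on C^I, acting on (C^I)^{ox n},
   whose basis is indexed by n.-tuple I *)
Definition tens_pow_op (I : finType) (n : nat) (M : I -> I -> C) :
  n.-tuple I -> n.-tuple I -> C :=
  fun t t' => \prod_(k < n) M (tnth t k) (tnth t' k).

Definition ptrace_R (dA dR : nat) (M : 'I_dA * 'I_dR -> 'I_dA * 'I_dR -> C) :
  'I_dA -> 'I_dA -> C :=
  fun a a' => \sum_(r : 'I_dR) M (a, r) (a', r).

(* pairing an A^n index with an R^n index into an (AR)^n index;
   this is the identification of (C^dA (x) C^dR)^{(x) n} with A^n R^n *)
Definition zip_idx (dA dR n : nat) (a : n.-tuple 'I_dA) (r : n.-tuple 'I_dR) :
  n.-tuple ('I_dA * 'I_dR) := [tuple (tnth a k, tnth r k) | k < n].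

Definition ptrace_Rn (dA dR n : nat)
  (M : n.-tuple ('I_dA * 'I_dR) -> n.-tuple ('I_dA * 'I_dR) -> C) :
  n.-tuple 'I_dA -> n.-tuple 'I_dA -> C :=
  fun a a' => \sum_(r : n.-tuple 'I_dR) M (zip_idx a r) (zip_idx a' r).

Definition is_purification (dA dR : nat) (P : 'I_dA -> 'I_dA -> C)
  (phi : 'I_dA * 'I_dR -> C) : Prop :=
  forall a a', ptrace_R (proj_op phi) a a' = P a a'.

Definition is_purification_n (dA dR n : nat) (P : 'I_dA -> 'I_dA -> C)
  (psi : n.-tuple ('I_dA * 'I_dR) -> C) : Prop :=
  forall a a', ptrace_Rn (proj_op psi) a a' = tens_pow_op (n:=n) P a a'.

Definition in_sym (I : finType) (n : nat) (psi : n.-tuple I -> C) : Prop :=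
  forall (s : 'S_n) (t : n.-tuple I), psi [tuple tnth t (s k) | k < n] = psi t.

(* g_{n,x} = dim Sym^n(C^x) *)
Definition g_dim (n x : nat) : nat := 'C(n + x - 1, n).

Definition cintegral (d : measure_display) (T : measurableType d)
  (mu : {measure set T -> \bar R}) (f : T -> C) : C :=
  Complex (Rintegral mu setT (fun t => complex.Re (f t)))
          (Rintegral mu setT (fun t => complex.Im (f t))).

End Ops.

(* Main.v *)
Require Import Defs.
From HB Require Import structures.
From mathcomp Require Import all_boot all_order all_algebra all_fingroup.
From mathcomp Require Import all_classical all_reals all_analysis.
From mathcomp Require Import complex ring lra.
Set Implicit Arguments. Unset Strict Implicit. Unset Printing Implicit Defensive.
Import Order.TTheory GRing.Theory Num.Theory.
Import numFieldNormedType.Exports.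
Local Open Scope ring_scope.
Local Open Scope classical_set_scope.
Local Open Scope sesquilinear_scope.

(** Regard a vector of A^n R^n as a matrix with rows indexed by A^n and columns
    by R^n, and let X0 be the n-th tensor power of one purification Phi of sigma.
    Then psi is X0 W, where W commutes with permutations and X0 W W^* = X0.

    No Haar measure is needed.  Among all finite convex combinations T of the
    projectors on the vectors (Phi U)^{(x) n}, U unitary, there is one of least
    Hilbert-Schmidt norm (by compactness and Caratheodory's theorem), and since
    the minimiser is unique, T commutes with right multiplication by every
    U^{(x) n}.  These operators span the commutant of the permutations (by the
    spectral theorem, polynomial continuation and polarisation), so T commutes
    with right multiplication by W as well.

    If T Z = X0, then T (Z W) = psi and <Z W, psi> = <Z, X0>.  By invariance
    <Z, X0> is the trace of an idempotent of rank at most rank T, hence at most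
    dim Sym^n; the Cauchy-Schwarz inequality for T concludes. *)

(** * Tensor powers and purifications *)

Lemma sum_tuple_prod (C : comPzSemiRingType) (I : finType) (n : nat)
    (f : 'I_n -> I -> C) :
  \sum_(t : n.-tuple I) \prod_(k < n) f k (tnth t k) =
  \prod_(k < n) \sum_(i : I) f k i.
Proof.
rewrite bigA_distr_bigA (reindex (fun g : {ffun 'I_n -> I} => [tuple g k | k < n])).
  by apply: eq_bigr => g _; apply: eq_bigr => k _; rewrite tnth_mktuple.
exists (fun t : n.-tuple I => [ffun k => tnth t k]) => [g _|t _].
  by apply/ffunP => k; rewrite ffunE tnth_mktuple.
by apply/eq_from_tnth => k; rewrite tnth_mktuple ffunE.
Qed.

Section TensorPower.
Variables (C : numClosedFieldType) (n : nat).

(** The factors may be rectangular, so that a purification, read as a [dA] by [dR] matrix, has a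
    tensor power too. Tuples are numbered by [enum_val] to make matrix rank and trace available. *)
Definition tens_pow_mx (a b : nat) (M : 'M[C]_(a, b)) :
    'M[C]_(#|{: n.-tuple 'I_a}|, #|{: n.-tuple 'I_b}|) :=
  \matrix_(i, j) \prod_(k < n) M (tnth (enum_val i) k) (tnth (enum_val j) k).

Lemma tens_pow_mxM (a b c : nat) (M : 'M[C]_(a, b)) (N : 'M[C]_(b, c)) :
  tens_pow_mx (M *m N) = tens_pow_mx M *m tens_pow_mx N.
Proof.
apply/matrixP => i j; rewrite !mxE.
under eq_bigr do rewrite mxE.
rewrite -(sum_tuple_prod (fun k l =>
  M (tnth (enum_val i) k) l * N l (tnth (enum_val j) k))).
rewrite (reindex (@enum_val _ {: n.-tuple 'I_b})); last exact/onW_bij/enum_val_bij.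
by apply: eq_bigr => l _; rewrite !mxE big_split.
Qed.

Lemma tens_pow_mx_adj (a b : nat) (M : 'M[C]_(a, b)) :
  tens_pow_mx (M ^t*) = (tens_pow_mx M) ^t*.
Proof.
apply/matrixP => i j; rewrite !mxE rmorph_prod.
by apply: eq_bigr => k _; rewrite !mxE.
Qed.

Lemma tens_pow_mx1 (a : nat) : tens_pow_mx (1%:M : 'M[C]_a) = 1%:M.
Proof.
apply/matrixP => i j; rewrite !mxE.
have [->|nij] := eqVneq i j; first by rewrite big1 // => k _; rewrite !mxE eqxx.
case: (pickP (fun k => tnth (enum_val i) k != tnth (enum_val j) k)) => [k nk|e].
  by rewrite (bigD1 k) //= !mxE (negbTE nk) mul0r.
case/eqP: nij; apply/enum_val_inj/eq_from_tnth => k.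
by apply/eqP/negPn; rewrite e.
Qed.

Lemma tens_pow_mx_unitary (a : nat) (U : 'M[C]_a) :
  U \is unitarymx -> tens_pow_mx U \is unitarymx.
Proof.
move=> /unitarymxP UU; apply/unitarymxP.
by rewrite -tens_pow_mx_adj -tens_pow_mxM UU tens_pow_mx1.
Qed.

End TensorPower.
Arguments tens_pow_mx {C} n {a b} M.

(** * Adjoints and positive semidefinite matrices *)

Section Adjoint.
Variable C : numClosedFieldType.

Lemma adjM (m n p : nat) (A : 'M[C]_(m, n)) (B : 'M[C]_(n, p)) :
  (A *m B) ^t* = B ^t* *m A ^t*.
Proof. by rewrite trmx_mul map_mxM. Qed.

Lemma mulmx_adj_diag (m n : nat) (A : 'M[C]_(m, n)) (i : 'I_m) :
  (A *m A ^t*) i i = \sum_j `|A i j| ^+ 2.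
Proof. by rewrite mxE; apply: eq_bigr => j _; rewrite !mxE normCK. Qed.

Lemma mulmx_adj_eq0 (m n : nat) (A : 'M[C]_(m, n)) : A *m A ^t* = 0 -> A = 0.
Proof.
move=> A0; apply/matrixP => i j; rewrite mxE; apply/eqP.
have /eqP := mulmx_adj_diag A i; rewrite A0 mxE eq_sym psumr_eq0 => [/allP|k _].
  by move=> /(_ j (mem_index_enum _)) /=; rewrite sqrf_eq0 normr_eq0.
by rewrite exprn_ge0.
Qed.

End Adjoint.

Section Positive.
Variable C : numClosedFieldType.

Definition psdmx (m : nat) (A : 'M[C]_m) : Prop :=
  forall v : 'rV[C]_m, 0 <= (v *m A *m v ^t*) 0 0.

(** Polarisation: the form is real at [u + v] and at [u + 'i *: v], which together give
    [(q v u)^* = q u v]. *)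
Lemma psdmx_hermitian (m : nat) (A : 'M[C]_m) : psdmx A -> A ^t* = A.
Proof.
move=> psdA.
pose q (u v : 'rV[C]_m) := (u *m A *m v ^t*) 0 0.
have qD u v : q (u + v) (u + v) = q u u + q v v + (q u v + q v u).
  rewrite /q linearD map_mxD !mulmxDl !mulmxDr !mxE; ring.
have qreal u v : (q u v + q v u)^* = q u v + q v u.
  have qr w : (q w w)^* = q w w by apply/CrealP/ger0_real/psdA.
  have -> : q u v + q v u = q (u + v) (u + v) - q u u - q v v by rewrite qD; ring.
  by rewrite !rmorphB /= !qr.
have qZl a u v : q (a *: u) v = a * q u v by rewrite /q -!scalemxAl mxE.
have qZr a u v : q u (a *: v) = a^* * q u v.
  by rewrite /q linearZ map_mxZ /= -scalemxAr mxE.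
have qsym u v : (q v u)^* = q u v.
  have := qreal u v; have := qreal u ('i *: v).
  rewrite !(qZl, qZr) !rmorphD !rmorphM /= conjCi rmorphN /= conjCi opprK.
  set a := q u v; set b := q v u; set a' := a^*; set b' := b^* => e1 e2.
  have {}e1 : a' - b' = b - a.
    apply: (mulfI (neq0Ci C)); rewrite !mulrBr.
    move/eqP: e1; rewrite -subr_eq0 => /eqP e1.
    by apply/eqP; rewrite -subr_eq0 -e1; apply/eqP; ring.
  have : (2 : C) * b' = 2 * a.
    have -> : 2 * b' = (a' + b') - (a' - b') by ring.
    by rewrite e1 e2; ring.
  by move/mulfI; apply; rewrite pnatr_eq0.
have qE i j : q (delta_mx 0 i) (delta_mx 0 j) = A i j.
  rewrite /q -rowE mxE (bigD1 j) //= big1 => [|k nkj].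
    by rewrite addr0 !mxE !eqxx rmorph1 mulr1.
  by rewrite !mxE (negbTE nkj) andbF rmorph0 mulr0.
by apply/matrixP => i j; rewrite !mxE -!qE qsym.
Qed.

Lemma hermitian_spectral (m : nat) (A : 'M[C]_m) : A ^t* = A ->
  exists2 V : 'M[C]_m, V \is unitarymx &
    exists d : 'rV[C]_m, A = V ^t* *m diag_mx d *m V.
Proof.
move=> hA; have /orthomx_spectralP e : A \is normalmx.
  by apply/normalmxP; rewrite hA.
exists (spectralmx A); first exact: spectral_unitarymx.
by exists (spectral_diag A); rewrite -invmx_unitary ?spectral_unitarymx.
Qed.

(** The eigenvalues are values of the form at the rows of [V], hence nonnegative, and their square
    roots give [S]. *)
Lemma psdmx_sqrt (m : nat) (A : 'M[C]_m) : psdmx A ->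
  exists S : 'M[C]_m, A = S *m S ^t*.
Proof.
move=> psdA; have [V uV [d eA]] := hermitian_spectral (psdmx_hermitian psdA).
have VV : V *m V ^t* = 1%:M by apply/unitarymxP.
have d0 i : 0 <= d 0 i.
  have -> : d 0 i = (V *m A *m V ^t*) i i.
    by rewrite eA !mulmxA VV mul1mx -mulmxA VV mulmx1 mxE eqxx.
  have := psdA (row i V); rewrite -row_mul mxE [in X in _ -> X]mxE.
  by congr (0 <= _); apply: eq_bigr => k _; rewrite !mxE.
exists (V ^t* *m diag_mx (map_mx sqrtC d)).
rewrite adjM trmxCK !mulmxA eA; congr (_ *m _); rewrite -mulmxA; congr (_ *m _).
rewrite tr_diag_mx map_diag_mx mulmx_diag; congr diag_mx.
apply/rowP => i; rewrite !mxE /= conj_Creal ?ger0_real ?sqrtC_ge0 //.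
by rewrite -expr2 sqrtCK.
Qed.

(** With [D = P A - A], the hypothesis gives [D A^* = 0], hence [D D^* = 0]. *)
Lemma mulmx_fix_range (m n : nat) (P : 'M[C]_m) (A : 'M[C]_(m, n)) :
  P *m (A *m A ^t*) = A *m A ^t* -> P *m A = A.
Proof.
move=> PA; apply/eqP; rewrite -subr_eq0; apply/eqP/mulmx_adj_eq0.
rewrite -{1}[A in _ - A]mul1mx -mulmxBl linearB map_mxB /= adjM.
rewrite -{2}[A ^t*]mulmx1 -mulmxBr mulmxA -[_ *m A *m _]mulmxA mulmxBl PA.
by rewrite mul1mx subrr mul0mx.
Qed.

(** If [A Q A = A], then [G = Q A Q^*] is Hermitian, and [A G A] reduces to [A Q^* A], the adjoint
    of [A Q A]. *)
Lemma hermitian_ginv (m : nat) (A : 'M[C]_m) : A ^t* = A ->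
  exists2 G : 'M[C]_m, G ^t* = G & A *m G *m A = A.
Proof.
move=> hA; have AQA : A *m pinvmx A *m A = A by rewrite mulmxKpV.
move: (pinvmx A) AQA => Q AQA; exists (Q *m A *m Q ^t*).
  by rewrite !adjM trmxCK hA mulmxA.
rewrite !mulmxA AQA -{2}hA -mulmxA -adjM -{1}hA -adjM.
by rewrite AQA hA.
Qed.

(* The size [r] is a variable, so that [A] can be rewritten without touching
   the dimensions of its factors. *)
Lemma rank_factorization (m n : nat) (A : 'M[C]_(m, n)) :
  exists (r : nat) (b : 'M[C]_(m, r)) (c : 'M[C]_(r, n))
         (l : 'M[C]_(r, m)) (q : 'M[C]_(n, r)),
    [/\ r = \rank A, A = b *m c, l *m b = 1%:M & c *m q = 1%:M].
Proof.
exists (\rank A), (col_base A), (row_base A), (pinvmx (col_base A)).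
exists (pinvmx (row_base A)); split=> //; first by rewrite mulmx_base.
  exact: mulVpmx (col_base_full A).
exact: mulmxVp (row_base_free A).
Qed.

(** Cancelling [b] on the left and [c] on the right in [b c b c = b c] leaves [c b = 1], of size the
    rank; [b c] and [c b] have the same trace. *)
Lemma mxtrace_idempotent (m : nat) (E : 'M[C]_m) :
  E *m E = E -> \tr E = (\rank E)%:R.
Proof.
have [r [b [c [l [q [<- -> L Q]]]]]] := rank_factorization E => EE.
rewrite mxtrace_mulC; suff -> : c *m b = 1%:M by rewrite mxtrace1.
rewrite -[c *m b]mul1mx -[X in X *m _]L -[LHS]mulmx1 -[X in _ *m X]Q.
transitivity (l *m (b *m c *m (b *m c)) *m q); first by rewrite !mulmxA.
by rewrite EE mulmxA L mul1mx Q.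
Qed.

End Positive.

(** * Purifications of a tensor power *)

Section Purification.
Variables (C : numClosedFieldType) (dA dR n : nat).
Variables (sigma : 'M[C]_dA).
Variable Psi : 'M[C]_(#|{: n.-tuple 'I_dA}|, #|{: n.-tuple 'I_dR}|).
Hypothesis psd_sigma : psdmx sigma.
Hypothesis PsiPsi : Psi *m Psi ^t* = tens_pow_mx n sigma.

(** Since [l] and [q] cut [sigma] down to the identity of size [r], the n-th tensor power of that
    identity factors through dimension [dR ^ n]. So [r ^ n <= dR ^ n], and [0 < n] lets the exponent
    be cancelled. *)
Lemma rank_le_of_tens_pow_purification : (0 < n)%N -> (\rank sigma <= dR)%N.
Proof.
have [r [b [c [l [q [<- e L Q]]]]]] := rank_factorization sigma => n0.
have e1 : tens_pow_mx n l *m Psi *m (Psi ^t* *m tens_pow_mx n q) = 1%:M.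
  rewrite !mulmxA -[_ *m Psi *m _]mulmxA PsiPsi -!tens_pow_mxM e.
  by rewrite mulmxA L mul1mx Q tens_pow_mx1.
have := mxrankM_maxr (tens_pow_mx n l *m Psi) (Psi ^t* *m tens_pow_mx n q).
rewrite e1 mxrank1 => /leq_trans /(_ (rank_leq_row _)).
by rewrite !card_tuple !card_ord leq_exp2r.
Qed.

(** The compression of [sigma] by [l] has a square root [S] of size [r]. Then [b] carries it back,
    because [b l] fixes [sigma], and [pid_mx r] embeds its [r] columns among the [dR] available
    ones. *)
Lemma purification_exists : (0 < n)%N ->
  exists Phi : 'M[C]_(dA, dR), Phi *m Phi ^t* = sigma.
Proof.
move=> n0; have rR := rank_le_of_tens_pow_purification n0.
have hs := psdmx_hermitian psd_sigma.
have [r [b [c [l [q [er e L Q]]]]]] := rank_factorization sigma.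
rewrite -er in rR.
have bls : b *m l *m sigma = sigma.
  by rewrite e !mulmxA -[b *m l *m b]mulmxA L mulmx1.
have [S eS] : exists S : 'M[C]_r, l *m sigma *m l ^t* = S *m S ^t*.
  apply: psdmx_sqrt => v.
  by have := psd_sigma (v *m l); rewrite adjM !mulmxA.
exists (b *m S *m pid_mx r).
have pp : (pid_mx r : 'M[C]_(r, dR)) *m (pid_mx r) ^t* = 1%:M.
  by rewrite tr_pid_mx map_pid_mx mul_pid_mx minnn (minn_idPr rR) pid_mx_1.
rewrite !adjM !mulmxA -[_ *m pid_mx r *m _]mulmxA pp mulmx1.
rewrite -[b *m S *m _]mulmxA -eS !mulmxA bls -{1}hs -mulmxA -!adjM.
by rewrite bls hs.
Qed.

(** Take [M = Phi^* G] with [G] a Hermitian generalised inverse of [sigma]. The power of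
    [Phi M = sigma G] fixes [Psi], and [Psi W^*] is the power of [sigma G Phi], which is [Phi]. *)
Lemma purification_intertwiner (Phi : 'M[C]_(dA, dR)) :
  Phi *m Phi ^t* = sigma ->
  exists M : 'M[C]_(dR, dA),
    let W := tens_pow_mx n M *m Psi in
    tens_pow_mx n Phi *m W = Psi /\
    tens_pow_mx n Phi *m W *m W ^t* = tens_pow_mx n Phi.
Proof.
move=> PhiE; have [G hG sGs] := hermitian_ginv (psdmx_hermitian psd_sigma).
exists (Phi ^t* *m G) => W.
have XW : tens_pow_mx n Phi *m W = Psi.
  rewrite /W mulmxA -tens_pow_mxM mulmxA PhiE; apply: mulmx_fix_range.
  by rewrite PsiPsi -tens_pow_mxM sGs.
split=> //; rewrite XW /W adjM mulmxA PsiPsi -tens_pow_mx_adj -tens_pow_mxM.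
rewrite adjM hG trmxCK mulmxA; congr tens_pow_mx.
by apply: mulmx_fix_range; rewrite PhiE sGs.
Qed.

End Purification.

(** * Weighted frames of matrices and their operators *)

Section Frame.
Variables (C : numClosedFieldType) (p q : nat).
Implicit Types X Y Z : 'M[C]_(p, q).

Definition frob X Y : C := \tr (X *m Y ^t*).

Lemma frobE X Y : frob X Y = \sum_i \sum_j X i j * (Y i j)^*.
Proof.
by apply: eq_bigr => i _; rewrite mxE; apply: eq_bigr => j _; rewrite !mxE.
Qed.

Lemma frob_conj X Y : (frob X Y)^* = frob Y X.
Proof.
rewrite !frobE rmorph_sum; apply: eq_bigr => i _; rewrite rmorph_sum.
by apply: eq_bigr => j _; rewrite rmorphM /= conjCK mulrC.
Qed.

Lemma frobDl X Y Z : frob (X + Y) Z = frob X Z + frob Y Z.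
Proof. by rewrite /frob mulmxDl mxtraceD. Qed.

Lemma frobZl a X Y : frob (a *: X) Y = a * frob X Y.
Proof. by rewrite /frob -scalemxAl mxtraceZ. Qed.

Lemma frob_suml (I : finType) (F : I -> 'M[C]_(p, q)) Y :
  frob (\sum_i F i) Y = \sum_i frob (F i) Y.
Proof. by rewrite /frob mulmx_suml raddf_sum. Qed.

Lemma frob_mulr X Y (W : 'M[C]_q) : frob (X *m W) Y = frob X (Y *m W ^t*).
Proof. by rewrite /frob adjM trmxCK mulmxA. Qed.

Lemma frob_unitary X Y (U : 'M[C]_q) : U \is unitarymx ->
  frob (X *m U) (Y *m U) = frob X Y.
Proof. by move=> /unitarymxP UU; rewrite frob_mulr -mulmxA UU mulmx1. Qed.

Variables (N : nat) (w : 'I_N -> C) (X : 'I_N -> 'M[C]_(p, q)).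

(** The operator [T] of the overview: the weighted sum of the rank-one operators of the [X k] on the
    Hilbert space of [p] by [q] matrices. *)
Definition frame_op Y : 'M[C]_(p, q) := \sum_k (w k * frob Y (X k)) *: X k.

Lemma frame_op_linear : linear frame_op.
Proof.
move=> a Y Z; rewrite /frame_op scaler_sumr -big_split; apply: eq_bigr => k _.
by rewrite frobDl frobZl /= scalerA -scalerDl; congr (_ *: _); ring.
Qed.
HB.instance Definition _ :=
  GRing.isLinear.Build C _ _ *:%R frame_op frame_op_linear.

(** Its rank is the dimension of the span of the [X k]. With [D] the diagonal matrix of weights,
    [frame_op] acts on vectorised matrices as [S^* D S]. *)
Definition synthesis : 'M[C]_(N, p * q) := \matrix_k mxvec (X k).

Lemma mxvec_frob Y Z : mxvec Y *m (mxvec Z) ^t* = (frob Y Z)%:M.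
Proof.
rewrite [LHS]mx11_scalar; congr (_%:M); rewrite mxE frobE.
rewrite (reindex _ (curry_mxvec_bij _ _)) /= pair_bigA /=.
by apply: eq_bigr => -[i j] _; rewrite !mxE !mxvecE.
Qed.

Lemma mxvec_synthesis Y k : (mxvec Y *m synthesis ^t*) 0 k = frob Y (X k).
Proof.
have <- : (mxvec Y *m (mxvec (X k)) ^t*) 0 0 = frob Y (X k).
  by rewrite mxvec_frob mxE eqxx.
rewrite !mxE.
by apply: eq_bigr => l _; rewrite !mxE.
Qed.

Lemma mxvec_frame_op Y :
  mxvec (frame_op Y) =
  mxvec Y *m (synthesis ^t* *m diag_mx (\row_k w k) *m synthesis).
Proof.
rewrite !mulmxA [RHS]mulmx_sum_row /frame_op linear_sum.
apply: eq_bigr => k _; rewrite linearZ rowK; congr (_ *: _).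
by rewrite mul_mx_diag mxE mxvec_synthesis mxE mulrC.
Qed.

Hypothesis w_ge0 : forall k, 0 <= w k.

(** Let [K] be the cokernel of [T]. From [K^* T K = 0] the matrix [D^(1/2) S K] vanishes, so row [k]
    of [S K] is zero as soon as [w k != 0]; this puts [X k] in the range of [T]. *)
Lemma frame_op_range k : w k != 0 -> exists Z, frame_op Z = X k.
Proof.
move=> wk; set T := synthesis ^t* *m diag_mx (\row_k w k) *m synthesis.
suff /submxP[z ez] : (mxvec (X k) <= T)%MS.
  by exists (vec_mx z); apply: (can_inj mxvecK); rewrite mxvec_frame_op vec_mxK.
rewrite submxE; set K := cokermx T.
have TK : K ^t* *m T *m K = 0 by rewrite -mulmxA mulmx_coker mulmx0.
pose H := diag_mx (\row_k sqrtC (w k)); pose S := H *m synthesis *m K.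
have HH : H ^t* *m H = diag_mx (\row_k w k).
  rewrite tr_diag_mx map_diag_mx mulmx_diag; congr diag_mx; apply/rowP => l.
  by rewrite !mxE /= conj_Creal ?ger0_real ?sqrtC_ge0 // -expr2 sqrtCK.
have SS : S ^t* *m S = 0.
  by rewrite -TK /T /S -HH !adjM !mulmxA.
have S0 : S = 0.
  have S'0 : S ^t* = 0 by apply: mulmx_adj_eq0; rewrite trmxCK.
  by rewrite -[S]trmxCK S'0 trmx0 map_mx0.
apply/eqP/rowP => l; have /matrixP/(_ k l) := S0.
rewrite /S -mulmxA mul_diag_mx !mxE => /eqP; rewrite mulf_eq0 sqrtC_eq0.
rewrite (negbTE wk) /= => /eqP eK; rewrite -[RHS]eK.
by apply: eq_bigr => j _; rewrite !mxE.
Qed.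

Lemma weighted_CauchySchwarz (a b : 'I_N -> C) :
  `|\sum_k w k * (a k * b k)| ^+ 2 <=
  (\sum_k w k * `|a k| ^+ 2) * (\sum_k w k * `|b k| ^+ 2).
Proof.
pose u := \row_k (sqrtC (w k) * a k); pose v := \row_k (sqrtC (w k) * (b k)^*).
have ws k : (sqrtC (w k))^* = sqrtC (w k).
  by rewrite conj_Creal ?ger0_real ?sqrtC_ge0.
have ss k : sqrtC (w k) * sqrtC (w k) = w k by rewrite -expr2 sqrtCK.
have : `|dotmx u v| ^+ 2 <= dotmx u u * dotmx v v := (CauchySchwarz _ u v).1.
rewrite !dotmxE !mxE.
congr (`|_| ^+ 2 <= _ * _); apply: eq_bigr => k _.
- by rewrite !mxE rmorphM /= conjCK ws -[in RHS]ss; ring.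
- by rewrite !mxE rmorphM /= ws normCK -[in RHS]ss; ring.
- by rewrite !mxE rmorphM /= conjCK ws normCK -[in RHS]ss; ring.
Qed.

(** * The bound for an invariant frame *)

Variables (X0 : 'M[C]_(p, q)) (V : 'I_N -> 'M[C]_q) (W : 'M[C]_q) (g : nat).
Hypothesis w_sum : \sum_k w k = 1.
Hypothesis V_unitary : forall k, V k \is unitarymx.
Hypothesis XE : forall k, X k = X0 *m V k.
Hypothesis frame_V : forall k Y, frame_op (Y *m V k) = frame_op Y *m V k.
Hypothesis frame_W : forall Y, frame_op (Y *m W) = frame_op Y *m W.
Hypothesis XWW : X0 *m W *m W ^t* = X0.
Hypothesis rank_le : (\rank synthesis <= g)%N.

(* [frob Z X0] is the trace of the idempotent [E] below, hence its rank. *)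
Lemma frame_op_preimage :
  exists2 Z, frame_op Z = X0 & frob Z X0 <= g%:R.
Proof.
have [k0 wk0] : exists k, w k != 0.
  apply/existsP; apply: contraTT isT => /existsPn w0.
  have := w_sum; rewrite big1 => [/eqP|k _]; first by rewrite eq_sym oner_eq0.
  by apply/eqP/negPn/w0.
have [Z1 eZ1] := frame_op_range wk0.
have VV k : V k *m (V k) ^t* = 1%:M by apply/unitarymxP.
have VV' k : (V k) ^t* *m V k = 1%:M.
  by apply/mulmx1C.
(* Invariance under [V k0] turns a preimage of [X k0] into one of [X0]. *)
pose Z := Z1 *m (V k0) ^t*.
have eZ : frame_op Z = X0.
  have := frame_V k0 Z; rewrite -mulmxA VV' mulmx1 eZ1 XE.
  by move/(congr1 (mulmx^~ ((V k0) ^t*))); rewrite -!mulmxA VV !mulmx1.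
(* Row [k] of [Zm] is [Z V k], a preimage of [X k] by invariance; in matrix form this is [SE]. *)
exists Z => //; pose Zm : 'M[C]_(N, p * q) := \matrix_k mxvec (Z *m V k).
pose D := diag_mx (\row_k w k); set S := synthesis.
have SE : S = Zm *m (S ^t* *m D *m S).
  apply/row_matrixP => k; rewrite row_mul !rowK -mxvec_frame_op frame_V eZ.
  by rewrite XE.
have D_adj : D ^t* = D.
  rewrite tr_diag_mx map_diag_mx; congr diag_mx; apply/rowP => k.
  by rewrite !mxE /= conj_Creal // ger0_real.
have herm : S *m Zm ^t* = Zm *m S ^t*.
  rewrite [in LHS]SE [in RHS]SE !adjM trmxCK D_adj.
  by rewrite !mulmxA.
(* Replacing [Zm S^*] by [S Zm^*] in the second copy of [E] makes [S^* D S] appear in [E E], and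
   [SE] absorbs it. *)
pose E := Zm *m S ^t* *m D.
have EE : E *m E = E.
  have -> : E *m E = Zm *m (S ^t* *m D *m S) *m Zm ^t* *m D.
    by rewrite {2}/E -herm /E !mulmxA.
  by rewrite -SE herm.
(* Diagonal entry [k] of [E] is [w k] times [<Z V k, X0 V k>], where the unitary [V k] cancels. *)
have trE : \tr E = frob Z X0.
  transitivity (\sum_k w k * frob Z X0); last by rewrite -mulr_suml w_sum mul1r.
  apply: eq_bigr => k _; rewrite /E mul_mx_diag !mxE mulrC; congr (_ * _).
  rewrite -(frob_unitary Z X0 (V_unitary k)) -XE -mxvec_synthesis mxE.
  by apply: eq_bigr => j _; rewrite !mxE.
rewrite -trE mxtrace_idempotent // ler_nat (leq_trans _ rank_le) //.
rewrite /E -mulmxA (leq_trans (mxrankM_maxr _ _)) //.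
by rewrite (leq_trans (mxrankM_maxl _ _)) // mxrank_map mxrank_tr.
Qed.

(** Expand [<X0 W, Y> = <T (Z W), Y>] over the frame and apply Cauchy-Schwarz. The first factor is
    the form of [T] at [Z W], namely [<Z W, X0 W>], which is [<Z, X0>] by [XWW]. *)
Lemma frame_bound Y :
  `|frob (X0 *m W) Y| ^+ 2 <= g%:R * \sum_k w k * `|frob (X k) Y| ^+ 2.
Proof.
have [Z eZ Zg] := frame_op_preimage.
rewrite -eZ -frame_W frob_suml.
under eq_bigr do rewrite frobZl -mulrA.
apply: le_trans (weighted_CauchySchwarz _ _) _.
apply: ler_wpM2r; first by apply: sumr_ge0 => k _; rewrite mulr_ge0 // exprn_ge0.
apply: le_trans _ Zg; rewrite -[X0 in frob Z X0]XWW.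
have -> : frob Z (X0 *m W *m W ^t*) = frob (Z *m W) (frame_op (Z *m W)).
  by rewrite frame_W eZ frob_mulr.
rewrite -frob_conj frob_suml rmorph_sum le_eqVlt; apply/orP; left.
apply/eqP/eq_bigr => k _.
rewrite frobZl -[frob (X k) _]frob_conj -mulrA -normCK rmorphM /=.
by rewrite !conj_Creal // ger0_real // exprn_ge0.
Qed.

End Frame.

(** * The commutant of the tensor powers of unitaries *)

Lemma poly_eq0_of_roots (C : idomainType) (P : {poly C}) (x : nat -> C) :
  injective x -> (forall k, P.[x k] = 0) -> P = 0.
Proof.
move=> injx P0; apply/eqP; apply: contraT => nP.
have := @max_poly_roots _ P [seq x k | k <- iota 0 (size P)] nP.
rewrite size_map size_iota ltnn => -> //.
  by apply/allP => _ /mapP[k _ ->]; apply/rootP.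
by rewrite map_inj_uniq ?iota_uniq.
Qed.

(** Ryser's formula for the permanent, by inclusion and exclusion: after expanding over maps [h],
    the signed sum over the sets [B] containing the image of [h] vanishes unless [h] is a bijection.
    It serves below as the polarisation identity. *)
Lemma ryser (C : comNzRingType) (n : nat) (f : 'I_n -> 'I_n -> C) :
  \sum_(B : {set 'I_n}) (-1) ^+ #|~: B| * \prod_k \sum_(j in B) f j k =
  \sum_(s : 'S_n) \prod_k f (s k) k.
Proof.
(* The product over [j] encodes both the sign and the condition that [B] contains the image of [h],
   so the sum over [B] factorises. *)
transitivity (\sum_(B : {set 'I_n}) \sum_(h : {ffun 'I_n -> 'I_n})
    (\prod_j (if j \in B then 1 else - (j \notin codom h)%:R)) *
    \prod_k f (h k) k).
  apply: eq_bigr => B _; rewrite bigA_distr_big big_distrr /= big_mkcond /=.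
  apply: eq_bigr => h _; case: ifPn => [/ffun_onP hB|].
    congr (_ * _); rewrite (bigID (mem B)) /= big1 => [|j ->//]; rewrite mul1r.
    rewrite -prodr_const [RHS](eq_bigr (fun=> -1)) => [|j nj].
      by apply: eq_bigl => j; rewrite inE.
    rewrite (negbTE nj); case: codomP => // -[k ej].
    by rewrite ej hB in nj.
  move=> nh; have [k hk] : exists k, h k \notin B.
    apply/existsP; rewrite -negb_forall; apply: contra nh => /forallP hB.
    exact/ffun_onP.
  by rewrite (bigD1 (h k)) //= (negbTE hk) codom_f /= oppr0 !mul0r.
rewrite exchange_big /=.
transitivity (\sum_(h : {ffun 'I_n -> 'I_n} | injectiveb h) \prod_k f (h k) k).
  rewrite [RHS]big_mkcond; apply: eq_bigr => h _; rewrite -big_distrl /=.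
  rewrite -(@bigA_distr _ _ _ _ _ _ (fun=> 1) (fun j => - (j \notin codom h)%:R)).
  case: ifPn => [/injectiveP injh|ninj].
    rewrite big1 ?mul1r // => j _.
    by rewrite (inj_card_onto injh) //= oppr0 addr0.
  have [j nj] : exists j, j \notin codom h.
    apply/existsP; rewrite -negb_forall; apply: contra ninj => /forallP sh.
    apply/card_uniqP; rewrite size_map -cardE; apply: eq_card => j.
    by rewrite [RHS]inE; apply: sh.
  by rewrite (bigD1 j) //= nj /= addrN !mul0r.
rewrite (reindex_onto (@pval _) (insubd (1%g : 'S_n))) /=; last first.
  by move=> h injh; rewrite insubdK.
apply: eq_big => [s|s _]; last by apply: eq_bigr => k _; rewrite pvalE.
by rewrite valKd eqxx andbT (valP s).
Qed.

Section Commutant.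
Variables (C : numClosedFieldType) (p d n : nat).
Local Notation q := #|{: n.-tuple 'I_d}|.
Variable F : {linear 'M[C]_(p, q) -> 'M[C]_(p, q)}.

Definition comm_right (M : 'M[C]_q) : Prop := forall Y, F (Y *m M) = F Y *m M.

Lemma comm_rightM M N : comm_right M -> comm_right N -> comm_right (M *m N).
Proof. by move=> cM cN Y; rewrite mulmxA cN cM mulmxA. Qed.

Lemma comm_rightZ a M : comm_right M -> comm_right (a *: M).
Proof. by move=> cM Y; rewrite -!scalemxAr linearZ /= cM. Qed.

Lemma comm_right_sum (I : finType) (P : pred I) (M : I -> 'M[C]_q) :
  (forall i, P i -> comm_right (M i)) -> comm_right (\sum_(i | P i) M i).
Proof.
move=> cM Y; rewrite !mulmx_sumr linear_sum; apply: eq_bigr => i Pi.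
exact: cM.
Qed.

(** Every entry of the commutator of [F] with the n-th tensor power of [A + y *: B] is a polynomial
    in [y] with infinitely many roots, hence zero. *)
Lemma comm_right_pencil (A B : 'M[C]_d) (x : nat -> C) (z : C) : injective x ->
  (forall k, comm_right (tens_pow_mx n (A + x k *: B))) ->
  comm_right (tens_pow_mx n (A + z *: B)).
Proof.
move=> injx cx Y.
(* [M J] is the tensor product with factor [B] at the positions in [J] and [A] elsewhere. *)
pose M (J : {set 'I_n}) : 'M[C]_q := \matrix_(i, j) \prod_(k < n)
  (if k \in J then B else A) (tnth (enum_val i) k) (tnth (enum_val j) k).
have tpE y : tens_pow_mx n (A + y *: B) = \sum_(J : {set 'I_n}) y ^+ #|J| *: M J.
  apply/matrixP => i j; rewrite summxE mxE.
  under eq_bigr do rewrite !mxE addrC.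
  rewrite bigA_distr; apply: eq_bigr => J _; rewrite !mxE.
  rewrite -prodr_const [X in X * _]big_mkcond -big_split; apply: eq_bigr => k _ /=.
  by case: ifP; rewrite ?mul1r.
have FE y : F (Y *m tens_pow_mx n (A + y *: B)) - F Y *m tens_pow_mx n (A + y *: B)
    = \sum_(J : {set 'I_n}) y ^+ #|J| *: (F (Y *m M J) - F Y *m M J).
  rewrite tpE !mulmx_sumr linear_sum -sumrB; apply: eq_bigr => J _.
  by rewrite -!scalemxAr linearZ /= scalerBr.
apply/eqP; rewrite -subr_eq0 FE; apply/eqP/matrixP => i j; rewrite summxE mxE.
pose P := \sum_(J : {set 'I_n}) ((F (Y *m M J) - F Y *m M J) i j)%:P * 'X^#|J|.
have PE y :
    \sum_(J : {set 'I_n}) (y ^+ #|J| *: (F (Y *m M J) - F Y *m M J)) i j = P.[y].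
  rewrite horner_sum; apply: eq_bigr => J _.
  by rewrite hornerM hornerC hornerXn [LHS]mxE mulrC.
rewrite PE (@poly_eq0_of_roots _ P x) ?horner0 // => k.
by rewrite -PE -summxE -FE cx subrr mxE.
Qed.

Hypothesis comm_unitary :
  forall U : 'M[C]_d, U \is unitarymx -> comm_right (tens_pow_mx n U).

(** The diagonal matrix is affine in [z] and unitary when [z] has modulus one, so polynomial
    continuation reaches every [z]. *)
Lemma comm_right_scale_coord (j : 'I_d) (z : C) :
  comm_right (tens_pow_mx n (diag_mx (\row_i if i == j then z else 1))).
Proof.
have E y : diag_mx (\row_i if i == j then y else 1) =
   diag_mx (\row_i (i != j)%:R) + y *: diag_mx (\row_i (i == j)%:R) :> 'M[C]_d.
  rewrite -linearZ -linearD /=; congr diag_mx; apply/rowP => i; rewrite !mxE.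
  by case: eqP; rewrite ?mulr1 ?mulr0 ?add0r ?addr0.
pose c (k : nat) : C := 1 + 'i * k%:R.
have cK k : (c k)^* = 1 - 'i * k%:R.
  by rewrite rmorphD rmorph1 rmorphM /= conjCi conjC_nat mulNr.
have c0 k : c k != 0.
  rewrite -normr_gt0 -(@pmulr_lgt0 _ `|c k|) -?expr2.
    rewrite normCK cK.
    have -> : c k * (1 - 'i * k%:R) = 1 + k%:R ^+ 2.
      rewrite /c; have := sqrCi C => i2.
      have -> : (1 + 'i * k%:R) * (1 - 'i * k%:R) =
          1 - 'i ^+ 2 * k%:R ^+ 2 :> C by ring.
      by rewrite i2 mulN1r opprK.
    by rewrite ltr_wpDr // exprn_ge0.
  rewrite normr_gt0; apply: contraTneq isT => ck0.
  have /eqP := cK k; rewrite ck0 rmorph0 eq_sym subr_eq0 => /eqP e.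
  by move: ck0; rewrite /c -e -mulr2n => /eqP; rewrite pnatr_eq0.
(* infinitely many points of the unit circle *)
pose x k := (c k)^* / c k.
have injx : injective x.
  move=> k l /eqP; rewrite /x eqr_div // !cK => /eqP e.
  have : 2 * 'i * (l%:R : C) = 2 * 'i * k%:R.
    have -> : 2 * 'i * (l%:R : C) =
        (1 - 'i * k%:R) * c l - (1 - 'i * l%:R) * c k + 2 * 'i * k%:R.
      by rewrite /c; ring.
    by rewrite e subrr add0r.
  move/mulfI; rewrite mulf_neq0 ?neq0Ci ?pnatr_eq0 // => /(_ isT)/eqP.
  by rewrite eqr_nat => /eqP.
rewrite E; apply: (comm_right_pencil _ injx) => k; rewrite -E.
apply: comm_unitary; apply/unitarymxP.
rewrite tr_diag_mx map_diag_mx mulmx_diag -[RHS]diag_const_mx; congr diag_mx.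
apply/rowP => i; rewrite !mxE /=; case: eqP => _; last by rewrite rmorph1 mulr1.
by rewrite /x rmorphM /= conjCK fmorphV mulf_div [X in _ / X]mulrC divff //
  mulf_neq0 // conjC_eq0.
Qed.

Lemma comm_right_diag (e : 'rV[C]_d) : comm_right (tens_pow_mx n (diag_mx e)).
Proof.
suff H (s : seq 'I_d) : uniq s ->
    comm_right (tens_pow_mx n (diag_mx (\row_i if i \in s then e 0 i else 1))).
  have := H _ (enum_uniq 'I_d); congr (comm_right (tens_pow_mx n (diag_mx _))).
  by apply/rowP => i; rewrite !mxE mem_enum.
elim: s => [_|j s IHs /= /andP[js us]].
  have -> : diag_mx (\row_i if i \in [::] then e 0 i else 1) = 1%:M :> 'M[C]_d.
    by rewrite -diag_const_mx; congr diag_mx; apply/rowP => i; rewrite !mxE.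
  by move=> Y; rewrite tens_pow_mx1 !mulmx1.
have -> : diag_mx (\row_i if i \in j :: s then e 0 i else 1) =
    diag_mx (\row_i if i == j then e 0 j else 1) *m
    diag_mx (\row_i if i \in s then e 0 i else 1) :> 'M[C]_d.
  rewrite mulmx_diag; congr diag_mx; apply/rowP => i; rewrite !mxE inE.
  by case: eqP => [->|]; rewrite ?(negbTE js) ?mulr1 ?mul1r.
rewrite tens_pow_mxM; apply: comm_rightM; last exact: IHs.
exact: comm_right_scale_coord.
Qed.

Lemma comm_right_hermitian (H : 'M[C]_d) :
  H ^t* = H -> comm_right (tens_pow_mx n H).
Proof.
move=> hH; have [V uV [e ->]] := hermitian_spectral hH.
rewrite !tens_pow_mxM; apply: comm_rightM; last exact: comm_unitary.
apply: comm_rightM; last exact: comm_right_diag.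
by apply: comm_unitary; rewrite trmxC_unitary.
Qed.

(** Write [M = H + 'i *: K] with [H] and [K] Hermitian. For natural [k] the matrix [H + k K] is
    Hermitian; continue from these points to ['i]. *)
Lemma comm_right_tens_pow (M : 'M[C]_d) : comm_right (tens_pow_mx n M).
Proof.
pose H := 2^-1 *: (M + M ^t*); pose K := ((- 'i) / 2) *: (M - M ^t*).
have n2 : (2 : C) != 0 by rewrite pnatr_eq0.
have -> : M = H + 'i *: K.
  rewrite /H /K scalerA mulrA mulrN -expr2 sqrCi opprK mul1r -scalerDr.
  rewrite addrACA subrr addr0 -mulr2n -[M *+ 2]scaler_nat.
  by rewrite scalerA mulVf // scale1r.
have c2 : (2^-1 : C)^* = 2^-1 by rewrite fmorphV /= conjC_nat.
have hH : H ^t* = H by rewrite linearZ map_mxZ linearD map_mxD /= trmxCK addrC c2.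
have hK : K ^t* = K.
  rewrite linearZ map_mxZ linearB map_mxB /= trmxCK rmorphM rmorphN /= conjCi.
  by rewrite c2 opprK -[M ^t* - M]opprB scalerN -scaleNr -mulNr.
move: H K hH hK => H K hH hK.
have injx : injective (fun k : nat => k%:R : C).
  by move=> k l /eqP; rewrite eqr_nat => /eqP.
apply: (comm_right_pencil _ injx) => k; apply: comm_right_hermitian.
by rewrite linearD map_mxD linearZ map_mxZ /= hH hK conjC_nat.
Qed.

Definition permute_tuple (I : finType) (s : 'S_n) (t : n.-tuple I) : n.-tuple I :=
  [tuple tnth t (s k) | k < n].

(** Averaging over permutations writes [W] as a combination of symmetrised tensor products of matrix
    units. By [ryser] each of these is a combination of tensor powers. *)
Lemma comm_right_symmetric (W : n.-tuple 'I_d -> n.-tuple 'I_d -> C) :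
  (forall s t t', W (permute_tuple s t) (permute_tuple s t') = W t t') ->
  comm_right (\matrix_(i, j) W (enum_val i) (enum_val j)).
Proof.
move=> Wsym.
have -> : (\matrix_(i, j) W (enum_val i) (enum_val j)) =
   \sum_(t : n.-tuple 'I_d) \sum_(t' : n.-tuple 'I_d) \sum_(B : {set 'I_n})
     (W t t' / n`!%:R * (-1) ^+ #|~: B|) *:
     tens_pow_mx n (\sum_(k in B) delta_mx (tnth t k) (tnth t' k)) :> 'M[C]_q.
  apply/matrixP => i j; rewrite mxE summxE.
  transitivity (\sum_(t : n.-tuple 'I_d) \sum_(t' : n.-tuple 'I_d)
      W t t' / n`!%:R * \sum_(s : 'S_n) \prod_k
        ((delta_mx (tnth t (s k)) (tnth t' (s k)) : 'M[C]_d)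
          (tnth (enum_val i) k) (tnth (enum_val j) k))).
    transitivity (\sum_(s : 'S_n) W (enum_val i) (enum_val j) / n`!%:R).
      by rewrite sumr_const card_Sn -[RHS]mulr_natr divfK.
    transitivity (\sum_(s : 'S_n) \sum_(t : n.-tuple 'I_d) \sum_(t' : n.-tuple 'I_d)
       W t t' / n`!%:R * \prod_k
        ((delta_mx (tnth t (s k)) (tnth t' (s k)) : 'M[C]_d)
          (tnth (enum_val i) k) (tnth (enum_val j) k))); last first.
      rewrite exchange_big; apply: eq_bigr => t _; rewrite exchange_big.
      by apply: eq_bigr => t' _; rewrite mulr_sumr.
    apply: eq_bigr => s _.
    have permK (u v : n.-tuple 'I_d) :
        (permute_tuple s u == v) = (u == permute_tuple s^-1%g v).
      by apply/eqP/eqP => [<-|->]; apply/eq_from_tnth => k;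
        rewrite !tnth_mktuple ?permKV ?permK.
    have prodE (t t' : n.-tuple 'I_d) : \prod_k
        ((delta_mx (tnth t (s k)) (tnth t' (s k)) : 'M[C]_d)
          (tnth (enum_val i) k) (tnth (enum_val j) k)) =
       ((t == permute_tuple s^-1%g (enum_val i)) &&
        (t' == permute_tuple s^-1%g (enum_val j)))%:R.
      rewrite -!permK; case: andP => [[/eqP ei /eqP ej]|nij].
        by rewrite big1 // => k _; rewrite mxE -ei -ej !tnth_mktuple !eqxx.
      case: (pickP (fun k => ~~ ((tnth (enum_val i) k == tnth t (s k)) &&
          (tnth (enum_val j) k == tnth t' (s k))))) => [k nk|ek].
        by rewrite (bigD1 k) //= mxE (negbTE nk) mul0r.
      case: nij; split; apply/eqP/eq_from_tnth => k; rewrite tnth_mktuple;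
        by have /negbFE/andP[/eqP e1 /eqP e2] := ek k.
    (* Only the pair obtained from the row and column words by [s^-1] contributes, and [Wsym] gives
       it the same coefficient for every [s]. *)
    rewrite (bigD1 (permute_tuple s^-1%g (enum_val i))) //=.
    rewrite (bigD1 (permute_tuple s^-1%g (enum_val j))) //=.
    rewrite prodE !eqxx mulr1 Wsym big1 => [|t' nt']; last first.
      by rewrite prodE (negbTE nt') andbF mulr0.
    rewrite big1 => [|t nt]; first by rewrite !addr0.
    by rewrite big1 // => t' _; rewrite prodE (negbTE nt) mulr0.
  apply: eq_bigr => t _; rewrite summxE; apply: eq_bigr => t' _; rewrite summxE.
  rewrite -(ryser (fun l k => (delta_mx (tnth t l) (tnth t' l) : 'M[C]_d)
          (tnth (enum_val i) k) (tnth (enum_val j) k))) mulr_sumr.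
  apply: eq_bigr => B _; rewrite mxE mulrA; congr (_ * _); rewrite mxE.
  by apply: eq_bigr => k _; rewrite summxE.
apply: comm_right_sum => t _; apply: comm_right_sum => t' _.
apply: comm_right_sum => B _; apply: comm_rightZ; exact: comm_right_tens_pow.
Qed.

End Commutant.

(** * The dimension of the symmetric subspace *)

(** A symmetric function of a word depends only on the sorted word, so the matrix factors through
    the space indexed by sorted words. *)
Lemma rank_symmetric_le (F : fieldType) (I : finType) (n N c : nat)
    (h : 'I_N -> n.-tuple I -> F) (col : 'I_c -> n.-tuple I) :
  (* Nonemptiness makes the truncated subtraction in the binomial exact. *)
  (0 < #|I|)%N -> (forall k (s : 'S_n) t, h k (permute_tuple s t) = h k t) ->
  (\rank (\matrix_(k, j) h k (col j)) <= 'C(n + #|I| - 1, n))%N.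
Proof.
move=> I0 hsym; have [m eI] : exists m, #|I| = m.+1.
  by exists #|I|.-1; rewrite prednK.
rewrite eI addnS subn1 /= -card_sorted_tuples; set S := finset _.
pose e (i : I) : 'I_m.+1 := cast_ord eI (enum_rank i).
pose e' (i : 'I_m.+1) : I := enum_val (cast_ord (esym eI) i).
have eK : cancel e e' by move=> i; rewrite /e /e' cast_ordK enum_rankK.
pose leI : rel 'I_m.+1 := relpre val leq.
pose st (t : n.-tuple I) := [tuple of sort leI [tuple e (tnth t k) | k < n]].
have stS t : st t \in S.
  by rewrite inE sorted_map; apply: sort_sorted => i j; apply: leq_total.
have hst k t : h k [tuple e' (tnth (st t) l) | l < n] = h k t.
  have : perm_eq (st t) [tuple e (tnth t l) | l < n] by rewrite perm_sort.
  case/tuple_permP => s es; rewrite -(hsym k s t); congr (h k _).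
  apply/eq_from_tnth => l; rewrite !tnth_mktuple.
  have -> : st t = [tuple tnth [tuple e (tnth t l0) | l0 < n] (s i) | i < n].
    exact: val_inj.
  by rewrite !tnth_mktuple eK.
have -> : \matrix_(k, j) h k (col j) =
  (\matrix_(k < N, l < #|S|) h k [tuple e' (tnth (enum_val l) i) | i < n]) *m
  (\matrix_(l < #|S|, j < c) (enum_val l == st (col j))%:R).
  apply/matrixP => k j; rewrite !mxE.
  rewrite (bigD1 (enum_rank_in (stS (col j)) (st (col j)))) //= !mxE.
  rewrite enum_rankK_in // eqxx mulr1 hst big1 ?addr0 // => l nl.
  rewrite !mxE; case: eqP => [el|]; last by rewrite mulr0.
  by case/eqP: nl; apply: enum_val_inj; rewrite enum_rankK_in.
exact: leq_trans (mxrankM_maxl _ _) (rank_leq_col _).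
Qed.

(** * The point of least norm in a convex hull *)

Section MinNorm.
Variable R : realType.

Lemma continuous_sumr (T : topologicalType) (I : finType) (F : I -> T -> R) :
  (forall i, continuous (F i)) -> continuous (fun x => \sum_i F i x).
Proof. by move=> cF; apply: (continuous_big add_continuous) => i _; exact: cF. Qed.

Lemma continuous_mulr (T : topologicalType) (f g : T -> R) :
  continuous f -> continuous g -> continuous (fun x => f x * g x).
Proof. by move=> cf cg x; apply: continuousM; [exact: cf|exact: cg]. Qed.

(** A constant coordinate 1, stored at [ord0], is adjoined to the points. A linear dependence in
    dimension [#|J|.+1] then has coefficients of sum zero. *)
Lemma affine_dependence (J : finType) (N : nat) (f : 'I_N -> J -> R) :
  (#|J|.+1 < N)%N ->
  exists c : 'I_N -> R,
    [/\ exists k, 0 < c k, \sum_k c k = 0 & forall j, \sum_k c k * f k j = 0].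
Proof.
move=> ltN.
pose Y : 'M[R]_(N, #|J|.+1) :=
  \matrix_(k, j) oapp (fun j' => f k (enum_val j')) 1 (unlift ord0 j).
have /rowV0Pn[c /sub_kermxP cY c0] : kermx Y != 0.
  rewrite kermx_eq0 /row_free; apply: contraTneq ltN => <-.
  by rewrite -leqNgt rank_leq_col.
have sc : \sum_k c 0 k = 0.
  have : (c *m Y) 0 ord0 = 0 by rewrite cY mxE.
  rewrite mxE => e; rewrite -[RHS]e.
  by apply: eq_bigr => k _; rewrite mxE unlift_none mulr1.
exists (fun k => c 0 k); split=> // [|j]; last first.
  have : (c *m Y) 0 (lift ord0 (enum_rank j)) = 0 by rewrite cY mxE.
  rewrite mxE => e; rewrite -[RHS]e; apply: eq_bigr => k _.
  by rewrite mxE liftK /= enum_rankK.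
(* Without a positive coefficient, all would be nonpositive with sum zero, hence zero. *)
apply: contrapT => /forallNP nc; case/eqP: c0; apply/rowP => k; rewrite mxE.
have cN l : 0 <= - c 0 l by rewrite oppr_ge0 leNgt; apply/negP/nc.
have /eqP : \sum_l - c 0 l = 0 by rewrite sumrN sc oppr0.
rewrite psumr_eq0 => [/allP/(_ k (mem_index_enum _))/=|l _]; last exact: cN.
by rewrite oppr_eq0 => /eqP.
Qed.

(** Subtract from [w] the multiple [s] of an affine dependence [c], where [s] is the least ratio
    [w k / c k] with [c k > 0]: weights stay nonnegative and one vanishes. *)
Lemma caratheodory_zero_weight (J : finType) (N : nat) (f : 'I_N -> J -> R)
    (w : 'I_N -> R) :
  (#|J|.+1 < N)%N -> (forall k, 0 <= w k) ->
  exists (w' : 'I_N -> R) (k0 : 'I_N),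
    [/\ forall k, 0 <= w' k, \sum_k w' k = \sum_k w k, w' k0 = 0 &
        forall j, \sum_k w' k * f k j = \sum_k w k * f k j].
Proof.
move=> ltN w0; have [c [[k1 ck1] sc fc]] := affine_dependence f ltN.
case: (@arg_minP _ _ _ k1 (fun k => 0 < c k) (fun k => w k / c k) ck1).
move=> k0 ck0 mink0; pose s := w k0 / c k0.
have s0 : 0 <= s by rewrite divr_ge0 // ltW.
exists (fun k => w k - s * c k), k0; split=> [k|||j].
- rewrite subr_ge0; case: (ltP 0 (c k)) => ck.
    by rewrite -ler_pdivlMr //; apply: mink0.
  by apply: le_trans (w0 k); rewrite mulr_ge0_le0.
- by rewrite big_split /= sumrN -mulr_sumr sc mulr0 subr0.
- by rewrite /s divfK ?subrr // gt_eqF.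
- under eq_bigr do rewrite mulrBl -mulrA.
  by rewrite big_split /= sumrN -mulr_sumr fc mulr0 subr0.
Qed.

(** For [a = <y, y>], [b = <y, z>], [c = <z, z>], the right side is the squared norm of
    [(1 - e) y + e z]. If [x = a - b] were positive, [e = x / (x + D)] would bring it below [a]. *)
Lemma le_of_segment_min (a b c : R) : 0 <= a - 2 * b + c ->
  (forall e, 0 <= e <= 1 ->
    a <= (1 - e) ^+ 2 * a + 2 * (e * (1 - e)) * b + e ^+ 2 * c) ->
  a <= b.
Proof.
move=> D0 H; rewrite leNgt; apply/negP => ltba.
set D := a - 2 * b + c in D0; pose x := a - b.
have x0 : 0 < x by rewrite subr_gt0.
have xD : 0 < x + D by rewrite ltr_pwDl.
pose e := x / (x + D).
have e0 : 0 < e by rewrite divr_gt0.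
have e1 : e <= 1 by rewrite ler_pdivrMr // mul1r lerDl.
have eD : e * D <= x.
  by rewrite /e mulrAC ler_pdivrMr // ler_pM2l // lerDr ltW.
have := H e; rewrite (ltW e0) e1 => /(_ isT).
have -> : (1 - e) ^+ 2 * a + 2 * (e * (1 - e)) * b + e ^+ 2 * c =
  a + e * (e * D - 2 * x) by rewrite /D /x; ring.
rewrite lerDl pmulr_rge0 // subr_ge0 => /le_trans /(_ eD).
by rewrite leNgt => /negP; apply; lra.
Qed.

(** The last inequality is the first-order condition at the point of least norm in the convex hull
    of the [f v]. *)
Lemma min_norm_hull (V : topologicalType) (J : finType) (f : V -> J -> R)
    (K : set V) :
  K !=set0 -> compact K -> (forall j, continuous (f^~ j)) ->
  exists (N : nat) (w : 'I_N -> R) (u : 'I_N -> V),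
    [/\ forall k, 0 <= w k, \sum_k w k = 1, forall k, K (u k) &
        forall v, K v ->
          \sum_j (\sum_k w k * f (u k) j) ^+ 2 <=
          \sum_j (\sum_k w k * f (u k) j) * f v j].
Proof.
(* Caratheodory's theorem needs [#|J|.+1] points; one more frees a slot for the competitor [v]. *)
move=> [v0 Kv0] cK cf; pose N := #|J|.+2.
pose P := prod_topology (fun _ : 'I_N => (R * V)%type).
pose A : set P := [set g | forall k, (`[0, 1]%classic `*` K) (g k)].
have cA : compact A.
  apply: (@tychonoff 'I_N (fun=> (R * V)%type) (fun=> `[0, 1]%classic `*` K)) => _.
  by apply: compact_setX => //; exact: segment_compact.
have c1 k : continuous (fun g : P => (g k).1).
  move=> g; apply: (@continuous_comp _ _ _ (fun g : P => g k) fst).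
    exact: (@proj_continuous 'I_N (fun=> (R * V)%type) k).
  exact: cvg_fst.
have c2 k : continuous (fun g : P => (g k).2).
  move=> g; apply: (@continuous_comp _ _ _ (fun g : P => g k) snd).
    exact: (@proj_continuous 'I_N (fun=> (R * V)%type) k).
  exact: cvg_snd.
pose B : set P := [set g | \sum_k (g k).1 = 1].
have cB : closed B.
  apply: (@preimage_closed _ _ (fun g : P => \sum_k (g k).1) [set x | x = 1]).
    by move=> g _; exact: continuous_sumr.
  exact: closed_eq.
pose F (g : P) := \sum_j (\sum_k (g k).1 * f (g k).2 j) ^+ 2.
have cF : continuous F.
  apply: continuous_sumr => j.
  have h : continuous (fun g : P => \sum_k (g k).1 * f (g k).2 j).
    apply: continuous_sumr => k; apply: continuous_mulr; first exact: c1.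
    move=> g; exact: (@continuous_comp _ _ _ (fun g : P => (g k).2) (f^~ j) g
                        (c2 k g) (cf j _)).
  exact: (continuous_mulr h h).
have AB0 : A `&` B !=set0.
  exists (fun k => ((k == ord0)%:R, v0)); split.
    by move=> k; split => //=; rewrite in_itv /=; case: eqP; rewrite ?lexx ?ler01.
  by rewrite /B /= (bigD1 ord0) //= big1 ?addr0 // => k /negbTE ->.
have [g /set_mem[Ag Bg] ming] := compact_EVT_min AB0 (compact_closedI cA cB)
  (continuous_subspaceT cF).
have w0 k : 0 <= (g k).1.
  by have [/= + _] := Ag k; rewrite in_itv /= => /andP[].
have Ku k : K (g k).2 by have [] := Ag k.
exists N, (fun k => (g k).1), (fun k => (g k).2); split=> // v Kv.
set y := fun j => \sum_k (g k).1 * f (g k).2 j.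
have [w' [k0 [w'0 w'1 w'k0 w'y]]] :=
  caratheodory_zero_weight (fun k => f (g k).2) (ltnSn #|J|.+1) w0.
apply: (@le_of_segment_min _ _ (\sum_j f v j ^+ 2)) => [|e /andP[e0 e1]].
  rewrite mulr_sumr -sumrB -big_split /=; apply: sumr_ge0 => j _.
  have -> : y j ^+ 2 - 2 * (y j * f v j) + f v j ^+ 2 = (y j - f v j) ^+ 2 by ring.
  exact: sqr_ge0.
(* The slot [k0] has weight zero in [w'], so [v] can be placed there with weight [e]; [h] then
   represents [(1 - e) y + e f v]. *)
pose h : P := fun k => ((1 - e) * w' k + e * (k == k0)%:R,
                        if k == k0 then v else (g k).2).
have h1 : \sum_k (h k).1 = 1.
  rewrite /h /= big_split /= -!mulr_sumr w'1 Bg (bigD1 k0) //= eqxx.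
  rewrite big1 => [|k /negbTE -> //].
  by rewrite addr0 !mulr1 subrK.
have h0 k : 0 <= (h k).1.
  by rewrite addr_ge0 // mulr_ge0 ?subr_ge0.
have hA : A h.
  move=> k; split => /=; last by case: ifP.
  rewrite in_itv /=; apply/andP; split; first exact: h0.
  by rewrite -[leRHS]h1 (bigD1 k) //= lerDl; apply: sumr_ge0 => i _; exact: h0.
have := ming h (mem_set (conj hA h1)).
have -> : F g = \sum_j y j ^+ 2 by [].
have yh j : \sum_k (h k).1 * f (h k).2 j = (1 - e) * y j + e * f v j.
  rewrite /y -w'y (bigD1 k0) //= [in RHS](bigD1 k0) //= w'k0 eqxx mul0r mulr0.
  rewrite add0r add0r.
  rewrite mulr1 addrC mulr_sumr; congr (_ + _); apply: eq_bigr => k /negbTE ->.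
  by rewrite mulr0 addr0 mulrA.
move=> /le_trans; apply; rewrite /F; under eq_bigr do rewrite yh.
rewrite !mulr_sumr -!big_split /=; apply: ler_sum => j _.
rewrite le_eqVlt; apply/orP; left; apply/eqP.
by rewrite -/(y j); move: (y j) => z; ring.
Qed.

End MinNorm.

(** * A finite unitarily invariant frame *)

Section ComplexParts.
Variable R : realType.
Local Notation C := R[i].

(** The boolean index makes the real coordinates of a complex array a family over a finite type. *)
Definition cpart (b : bool) (z : C) : R := if b then complex.Re z else complex.Im z.

Lemma cpartD b (x y : C) : cpart b (x + y) = cpart b x + cpart b y.
Proof. by case: b x y => -[? ?] [? ?]. Qed.

Lemma cpart_sum (I : finType) b (F : I -> C) :
  cpart b (\sum_i F i) = \sum_i cpart b (F i).
Proof. by apply: (big_morph (cpart b) (cpartD b)); case: b. Qed.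

Lemma cpartZ b (a : R) (z : C) : cpart b (a%:C%C * z) = a * cpart b z.
Proof. by case: b; case: z => x y /=; rewrite mul0r ?subr0 ?addr0. Qed.

Lemma cpart_inj (x y : C) : (forall b, cpart b x = cpart b y) -> x = y.
Proof.
by case: x y => [a b] [a' b'] e; rewrite (e true : a = a') (e false : b = b').
Qed.

Lemma cpart_dot (x y : C) :
  \sum_(b : bool) cpart b x * cpart b y = complex.Re (x^* * y).
Proof.
by rewrite big_bool; case: x y => [a b] [a' b'] /=; rewrite mulNr opprK.
Qed.

Definition continuousC (T : topologicalType) (h : T -> C) : Prop :=
  forall b, continuous (fun x => cpart b (h x)).

Lemma eq_continuousC (T : topologicalType) (f g : T -> C) :
  f =1 g -> continuousC f -> continuousC g.
Proof. by move=> /funext ->. Qed.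

Lemma continuousC_cst (T : topologicalType) (c : C) : continuousC (fun _ : T => c).
Proof. by move=> b; exact: cst_continuous. Qed.

Lemma continuousC_sum (T : topologicalType) (I : finType) (F : I -> T -> C) :
  (forall i, continuousC (F i)) -> continuousC (fun x => \sum_i F i x).
Proof.
move=> cF b; under eq_fun do rewrite cpart_sum.
by apply: continuous_sumr => i; exact: cF.
Qed.

Lemma continuousC_mul (T : topologicalType) (f g : T -> C) :
  continuousC f -> continuousC g -> continuousC (fun x => f x * g x).
Proof.
move=> cf cg [].
- have -> : (fun x => cpart true (f x * g x)) = (fun x =>
      cpart true (f x) * cpart true (g x) - cpart false (f x) * cpart false (g x)).
    by apply/funext => x /=; case: (f x) (g x) => [? ?] [? ?].
  move=> x; apply: (continuousB (continuous_mulr (cf true) (cg true) (x := x))).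
  exact: (continuous_mulr (cf false) (cg false)).
- have -> : (fun x => cpart false (f x * g x)) = (fun x =>
      cpart true (f x) * cpart false (g x) + cpart false (f x) * cpart true (g x)).
    by apply/funext => x /=; case: (f x) (g x) => [? ?] [? ?].
  move=> x; apply: (continuousD (continuous_mulr (cf true) (cg false) (x := x))).
  exact: (continuous_mulr (cf false) (cg true)).
Qed.

Lemma continuousC_prod (T : topologicalType) (n : nat) (F : 'I_n -> T -> C) :
  (forall i, continuousC (F i)) -> continuousC (fun x => \prod_i F i x).
Proof.
elim: n F => [|n IHn] F cF.
  under eq_fun do rewrite big_ord0; exact: continuousC_cst.
under eq_fun do rewrite big_ord_recl.
apply: continuousC_mul; first exact: cF.
by apply: IHn => i; exact: cF.
Qed.

Lemma continuousC_conj (T : topologicalType) (f : T -> C) :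
  continuousC f -> continuousC (fun x => (f x)^*).
Proof.
move=> cf [].
  have -> : (fun x => cpart true (f x)^*) = (fun x => cpart true (f x)).
    by apply/funext => x /=; case: (f x).
  exact: cf.
have -> : (fun x => cpart false (f x)^*) = (fun x => - cpart false (f x)).
  by apply/funext => x /=; case: (f x).
by move=> x; apply: continuousN; exact: cf.
Qed.

End ComplexParts.

(** * Compactness of the unitary group *)

Section UnitaryCompact.
Variables (R : realType) (d : nat).
Local Notation C := R[i].

Definition mx_coords := prod_topology (fun _ : bool * 'I_d * 'I_d => R).

Definition mx_of_coords (v : mx_coords) : 'M[C]_d :=
  \matrix_(i, j) Complex (v (true, i, j)) (v (false, i, j)).

Definition coords_of_mx (M : 'M[C]_d) : mx_coords :=
  fun x => cpart x.1.1 (M x.1.2 x.2).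

Lemma coords_of_mxK (M : 'M[C]_d) : mx_of_coords (coords_of_mx M) = M.
Proof. by apply/matrixP => i j; rewrite !mxE /coords_of_mx /=; case: (M i j). Qed.

Lemma continuousC_mx_of_coords i j :
  continuousC (fun v : mx_coords => mx_of_coords v i j).
Proof.
move=> b.
have -> : (fun v : mx_coords => cpart b (mx_of_coords v i j)) =
    (fun v => v (b, i, j)).
  by apply/funext => v; rewrite mxE; case: b.
exact: (@proj_continuous _ (fun _ : bool * 'I_d * 'I_d => R) (b, i, j)).
Qed.

(** The rows of a unitary matrix have norm one, so its coordinates lie in a box, compact by
    Tychonoff; the entrywise equations of unitarity are closed conditions. *)
Lemma unitary_coords_compact :
  compact [set v : mx_coords | mx_of_coords v \is unitarymx].
Proof.
set K := [set v | _].
pose A : set mx_coords := [set v | forall x, `[-1, 1]%classic (v x)].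
have cA : compact A.
  apply: (@tychonoff _ (fun _ : bool * 'I_d * 'I_d => R) (fun=> `[-1, 1]%classic)).
  by move=> x; exact: segment_compact.
have -> : K = A `&` K.
  rewrite setIidr // => v /unitarymxP vK -[[b i] j].
  have := mulmx_adj_diag (mx_of_coords v) i; rewrite vK mxE eqxx mulr1n => e.
  have le1 : `|mx_of_coords v i j| ^+ 2 <= 1.
    rewrite e (bigD1 j) //= lerDl; apply: sumr_ge0 => k _; exact: exprn_ge0.
  have : v (true, i, j) ^+ 2 + v (false, i, j) ^+ 2 <= 1.
    move: le1; rewrite normCK mxE => /=; rewrite lecE /= => /andP[_].
    by rewrite mulrN opprK !expr2.
  move=> le2; rewrite /= in_itv /= -ler_norml -(@expr_le1 _ 2) //.
  rewrite real_normK ?num_real //.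
  apply: le_trans le2; case: b; first by rewrite lerDl sqr_ge0.
  by rewrite lerDr sqr_ge0.
apply: compact_closedI => //.
pose e (x : 'I_d * 'I_d * bool) (v : mx_coords) :=
  cpart x.2 ((mx_of_coords v *m (mx_of_coords v) ^t*) x.1.1 x.1.2).
have ce x : continuous (e x).
  pose h v := \sum_k mx_of_coords v x.1.1 k * (mx_of_coords v x.1.2 k)^*.
  have ch : continuousC h.
    apply: continuousC_sum => k; apply: continuousC_mul.
      exact: continuousC_mx_of_coords.
    by apply: continuousC_conj; exact: continuousC_mx_of_coords.
  have -> : e x = (fun v => cpart x.2 (h v)); last exact: ch.
  apply/funext => v; rewrite /e mxE.
  by congr cpart; apply: eq_bigr => k _; rewrite !mxE.
have -> : K = \bigcap_(x in setT)
    (e x @^-1` [set y | y = cpart x.2 ((1%:M : 'M[C]_d) x.1.1 x.1.2)]).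
  apply/seteqP; split=> v.
    by move=> /unitarymxP vK x _; rewrite /e /= vK.
  move=> H; apply/unitarymxP/matrixP => i j; apply: cpart_inj => b.
  exact: (H (i, j, b) I).
apply: closed_bigI => x _; apply: preimage_closed; last exact: closed_eq.
by move=> v _; exact: ce.
Qed.

End UnitaryCompact.

(** * The invariant frame from the least-norm point *)

Section InvariantFrame.
Variables (R : realType) (p d n : nat).
Local Notation C := R[i].
Local Notation q := #|{: n.-tuple 'I_d}|.
Variable X0 : 'M[C]_(p, q).

Let X (v : mx_coords R d) : 'M[C]_(p, q) := X0 *m tens_pow_mx n (mx_of_coords v).

Let J : finType := (('I_p * 'I_q) * ('I_p * 'I_q) * bool)%type.

(** Real coordinates of the rank-one operator of [X v]; the Euclidean norm here is the
    Hilbert-Schmidt norm. *)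
Let f (v : mx_coords R d) (j : J) : R :=
  cpart j.2 ((X v j.1.1.1 j.1.1.2)^* * X v j.1.2.1 j.1.2.2).

Let continuous_f j : continuous (f^~ j).
Proof.
have cX i l : continuousC (fun v => X v i l).
  apply: (@eq_continuousC _ _ (fun v => \sum_k X0 i k * \prod_h
    mx_of_coords v (tnth (enum_val k) h) (tnth (enum_val l) h))).
    by move=> v; rewrite mxE; apply: eq_bigr => k _; rewrite mxE.
  apply: continuousC_sum => k; apply: continuousC_mul; first exact: continuousC_cst.
  by apply: continuousC_prod => h; exact: continuousC_mx_of_coords.
have := continuousC_mul (continuousC_conj (cX j.1.1.1 j.1.1.2)) (cX j.1.2.1 j.1.2.2).
exact.
Qed.

(** This is the squared modulus of [<X u, X v>], unchanged when both matrices are multiplied on the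
    right by one unitary. *)
Let dot_f u v : \sum_j f u j * f v j =
  complex.Re (frob (X u) (X v) * frob (X v) (X u)).
Proof.
rewrite -(pair_bigA _ (fun s b => f u (s, b) * f v (s, b))) /=.
under eq_bigr do rewrite /f /= cpart_dot rmorphM /= conjCK.
rewrite !frobE !pair_bigA big_distrlr /= -[RHS]/(cpart true _) cpart_sum.
under [RHS]eq_bigr do rewrite cpart_sum.
rewrite pair_bigA; apply: eq_bigr => -[s t] _; congr (complex.Re _) => /=.
by rewrite mulrACA [X in _ * X]mulrC.
Qed.

(** Let [y] be the minimiser and [y'] its translate by [V]. They have equal norms, and minimality
    gives [<y, y> <= <y, y'>], so [y = y']: the translated frame has the same operator. *)
Lemma invariant_frame :
  exists (N : nat) (w : 'I_N -> R) (U : 'I_N -> 'M[C]_d),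
    [/\ forall k, 0 <= w k, \sum_k w k = 1, forall k, U k \is unitarymx &
        forall V : 'M[C]_d, V \is unitarymx -> forall Y,
          let F := frame_op (fun k => (w k)%:C%C)
                            (fun k => X0 *m tens_pow_mx n (U k)) in
          F (Y *m tens_pow_mx n V) = F Y *m tens_pow_mx n V].
Proof.
have K0 : [set v : mx_coords R d | mx_of_coords v \is unitarymx] !=set0.
  exists (coords_of_mx 1%:M); rewrite /= coords_of_mxK.
  by apply/unitarymxP; rewrite trmx1 map_mx1 mulmx1.
have [N [w [u [w0 w1 uU umin]]]] :=
  min_norm_hull K0 (@unitary_coords_compact R d) continuous_f.
exists N, w, (fun k => mx_of_coords (u k)); split=> // V uV Y F.
pose u' k := coords_of_mx (mx_of_coords (u k) *m V).
have XV k : X (u' k) = X (u k) *m tens_pow_mx n V.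
  by rewrite /X coords_of_mxK tens_pow_mxM mulmxA.
have uVn := tens_pow_mx_unitary n uV.
pose y j := \sum_k w k * f (u k) j; pose y' j := \sum_k w k * f (u' k) j.
have normE (z : 'I_N -> mx_coords R d) : \sum_j (\sum_k w k * f (z k) j) ^+ 2 =
    \sum_k \sum_l w k * w l * \sum_j f (z k) j * f (z l) j.
  under eq_bigr do rewrite expr2 big_distrlr /=.
  rewrite exchange_big /=; apply: eq_bigr => k _.
  rewrite exchange_big /=; apply: eq_bigr => l _.
  by rewrite mulr_sumr; apply: eq_bigr => j _; ring.
have yy' : \sum_j y' j ^+ 2 = \sum_j y j ^+ 2.
  rewrite /y /y' !normE; apply: eq_bigr => k _; apply: eq_bigr => l _.
  by rewrite !dot_f !XV !frob_unitary.
(* The translated points are again unitary, so [umin] holds at each of them and can be averaged with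
   the weights. *)
have le_yy' : \sum_j y j ^+ 2 <= \sum_j y j * y' j.
  have -> : \sum_j y j * y' j = \sum_k w k * \sum_j y j * f (u' k) j.
    under eq_bigr do rewrite mulr_sumr.
    rewrite exchange_big /=; apply: eq_bigr => k _; rewrite mulr_sumr.
    by apply: eq_bigr => j _; rewrite mulrCA.
  rewrite -[leLHS]mul1r -w1 mulr_suml; apply: ler_sum => k _.
  apply: ler_wpM2l => //; apply: umin; rewrite /= coords_of_mxK.
  exact: (mul_unitarymx (uU k) uV).
have eqy j : y j = y' j.
  have : \sum_j (y j - y' j) ^+ 2 <= 0.
    have -> : \sum_j (y j - y' j) ^+ 2 =
        \sum_j y j ^+ 2 + \sum_j y' j ^+ 2 - 2 * \sum_j y j * y' j.
      rewrite mulr_sumr -big_split -sumrB /=; apply: eq_bigr => i _; ring.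
    by rewrite yy'; lra.
  have ge0 i : true -> 0 <= (y i - y' i) ^+ 2 by rewrite sqr_ge0.
  move=> le0; have /eqP : \sum_j (y j - y' j) ^+ 2 = 0.
    by apply/eqP; rewrite eq_le le0 sumr_ge0.
  rewrite psumr_eq0 // => /allP/(_ j (mem_index_enum _)).
  by rewrite /= sqrf_eq0 subr_eq0 => /eqP.
have TE s t : \sum_k (w k)%:C%C * ((X (u k) s.1 s.2)^* * X (u k) t.1 t.2) =
              \sum_k (w k)%:C%C * ((X (u' k) s.1 s.2)^* * X (u' k) t.1 t.2).
  apply: cpart_inj => b; rewrite !cpart_sum.
  under eq_bigr do rewrite cpartZ.
  under [RHS]eq_bigr do rewrite cpartZ.
  exact: (eqy (s, t, b)).
have frameE (Z : 'I_N -> 'M[C]_(p, q)) M i l :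
    frame_op (fun k => (w k)%:C%C) Z M i l =
    \sum_s M s.1 s.2 * \sum_k (w k)%:C%C * ((Z k s.1 s.2)^* * Z k i l).
  rewrite /frame_op summxE; under eq_bigr do rewrite mxE frobE pair_bigA /=.
  under [RHS]eq_bigr do rewrite mulr_sumr.
  rewrite exchange_big /=; apply: eq_bigr => k _.
  rewrite mulr_sumr mulr_suml; apply: eq_bigr => s _; ring.
have FE M : F M = frame_op (fun k => (w k)%:C%C) (fun k => X (u' k)) M.
  apply/matrixP => i l; rewrite /F !frameE; apply: eq_bigr => s _.
  by congr (_ * _); exact: (TE s (i, l)).
(* In the translated frame the unitary cancels inside [frob] and remains as a right factor of each
   term. *)
rewrite FE /frame_op /F /frame_op mulmx_suml; apply: eq_bigr => k _.
by rewrite XV frob_unitary // -scalemxAl.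
Qed.

End InvariantFrame.

(** * Finitely supported probabilities *)

Section FiniteProbability.
Variables (R : realType) (N : nat) (w : nat -> {nonneg R}).
Hypothesis w_sum : \sum_(k < N) (w k)%:num = 1.

(** The atoms sit in [nat], where every set, hence every function, is measurable. *)
Definition finite_prob : set nat -> \bar R :=
  msum (fun k : nat => mscale (w k) \d_k) N.

HB.instance Definition _ := Measure.on finite_prob.

Let finite_prob_setT : finite_prob setT = 1%E.
Proof.
rewrite /finite_prob /msum /=.
under eq_bigr do rewrite /mscale /= diracT mule1.
by rewrite sumEFin w_sum.
Qed.

HB.instance Definition _ :=
  @Measure_isProbability.Build _ _ R finite_prob finite_prob_setT.

Definition finite_probability : probability nat R := finite_prob.

Let integral_finite_prob (f : nat -> R) : (forall k, 0 <= f k) ->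
  (\int[finite_prob]_x (f x)%:E = (\sum_(k < N) (w k)%:num * f k)%:E)%E.
Proof.
move=> f0; have f0E (x : nat) : setT x -> (0 <= (f x)%:E)%E by rewrite lee_fin.
rewrite ge0_integral_measure_sum //= -sumEFin; apply: eq_bigr => k _.
by rewrite ge0_integral_mscale //= integral_dirac //= diracT mul1e.
Qed.

(** The formula for nonnegative functions is applied to the positive and negative parts. *)
Lemma Rintegral_finite_prob (f : nat -> R) :
  Rintegral finite_prob setT f = \sum_(k < N) (w k)%:num * f k.
Proof.
rewrite /Rintegral integralE.
under eq_integral do rewrite funeposE -EFin_max.
under [X in (_ - X)%E]eq_integral do rewrite funenegE -EFinN -EFin_max.
rewrite !integral_finite_prob; last 2 first.
- by move=> k; rewrite le_max lexx orbT.
- by move=> k; rewrite le_max lexx orbT.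
rewrite /= -sumrB; apply: eq_bigr => k _; rewrite -mulrBr; congr (_ * _).
by rewrite /Num.max; case: ltP => h1; case: ltP => h2; lra.
Qed.

End FiniteProbability.

Lemma finite_probability_exists (R : realType) (N : nat) (w : 'I_N -> R) :
  (forall k, 0 <= w k) -> \sum_k w k = 1 ->
  exists P : probability nat R, forall f : nat -> R,
    Rintegral P setT f = \sum_(k < N) w k * f k.
Proof.
move=> w0 w1; pose v (k : nat) : R := if insub k is Some i then w i else 0.
have v0 k : 0 <= v k by rewrite /v; case: insub.
have vE (k : 'I_N) : v k = w k by rewrite /v valK.
have v1 : \sum_(k < N) (NngNum (v0 k))%:num = 1.
  by rewrite -w1; apply: eq_bigr => k _; rewrite /= vE.
exists (@finite_probability _ _ (fun k => NngNum (v0 k)) v1) => f.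
by rewrite [LHS]Rintegral_finite_prob; apply: eq_bigr => k _; rewrite /= vE.
Qed.

(** * Words over pairs as pairs of words *)

Section Indices.
Variables (dA dR n : nat).

Lemma permute_zip_idx (s : 'S_n) (a : n.-tuple 'I_dA) (r : n.-tuple 'I_dR) :
  permute_tuple s (zip_idx a r) =
  zip_idx (permute_tuple s a) (permute_tuple s r).
Proof. by apply/eq_from_tnth => k; rewrite !tnth_mktuple. Qed.

Lemma sum_zip_idx (C : nmodType) (F : n.-tuple ('I_dA * 'I_dR) -> C) :
  \sum_t F t =
  \sum_(i < #|{: n.-tuple 'I_dA}|) \sum_(j < #|{: n.-tuple 'I_dR}|)
    F (zip_idx (enum_val i) (enum_val j)).
Proof.
rewrite pair_bigA /= (reindex (fun x : 'I_#|{: n.-tuple 'I_dA}| *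
  'I_#|{: n.-tuple 'I_dR}| => zip_idx (enum_val x.1) (enum_val x.2))) //.
exists (fun t => (enum_rank [tuple (tnth t k).1 | k < n],
                  enum_rank [tuple (tnth t k).2 | k < n])) => [[i j] _|t _] /=.
  congr pair; rewrite -[RHS]enum_valK; congr enum_rank;
    by apply/eq_from_tnth => k; rewrite !tnth_mktuple.
rewrite !enum_rankK; apply/eq_from_tnth => k; rewrite !tnth_mktuple.
by case: (tnth t k).
Qed.

(** Up to vectorisation, row [k] lists the values of the symmetric function [h k] at words over
    pairs, so [rank_symmetric_le] applies. *)
Lemma rank_synthesis_le (C : numClosedFieldType) (N : nat)
    (h : 'I_N -> n.-tuple ('I_dA * 'I_dR) -> C) :
  (0 < dA)%N -> (0 < dR)%N ->
  (forall k (s : 'S_n) t, h k (permute_tuple s t) = h k t) ->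
  (\rank (synthesis (fun k =>
      \matrix_(i < #|{: n.-tuple 'I_dA}|, j < #|{: n.-tuple 'I_dR}|)
        h k (zip_idx (enum_val i) (enum_val j)))) <= g_dim n (dA * dR))%N.
Proof.
move=> A0 R0 hsym.
pose col (j : 'I_(#|{: n.-tuple 'I_dA}| * #|{: n.-tuple 'I_dR}|)) :=
  let ij := enum_val (cast_ord (esym (mxvec_cast _ _)) j) in
  zip_idx (enum_val ij.1) (enum_val ij.2).
have cardI : #|{: 'I_dA * 'I_dR}| = (dA * dR)%N by rewrite card_prod !card_ord.
rewrite /g_dim -cardI.
have := rank_symmetric_le col _ hsym; rewrite cardI muln_gt0 A0 R0 => /(_ isT).
congr (\rank _ <= _)%N; apply/matrixP => k j; rewrite !mxE.
case/mxvec_indexP: j => i j; rewrite mxvecE mxE /col /mxvec_index.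
by rewrite cast_ordK enum_rankK.
Qed.

End Indices.

Lemma proj_op_form (R : realType) (I : finType) (x v : I -> R[i]) :
  \sum_i \sum_j (v i)^* * proj_op x i j * v j = `|\sum_i x i * (v i)^*| ^+ 2.
Proof.
rewrite normCK rmorph_sum big_distrlr /=; apply: eq_bigr => i _.
by apply: eq_bigr => j _; rewrite /proj_op rmorphM /= conjCK; ring.
Qed.

Lemma tens_pow_proj_op (R : realType) (I : finType) (n : nat) (x : I -> R[i]) t t' :
  tens_pow_op (n := n) (proj_op x) t t' =
  proj_op (fun t : n.-tuple I => \prod_(k < n) x (tnth t k)) t t'.
Proof. by rewrite /tens_pow_op /proj_op big_split /= rmorph_prod. Qed.

(** * From the invariant frame to the operator inequality *)

Theorem theorem1 (R : realType) (dA dR n : nat)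
  (hA : (0 < dA)%N) (hR : (0 < dR)%N) (hn : (0 < n)%N)
  (sigma : 'I_dA -> 'I_dA -> R[i]) (Hsigma : psd_op sigma)
  (psi : n.-tuple ('I_dA * 'I_dR) -> R[i])
  (Hpur : is_purification_n sigma psi)
  (Hsym : in_sym psi) :
  exists (d : measure_display) (T : measurableType d)
         (P : probability T R) (phi : T -> 'I_dA * 'I_dR -> R[i]),
    (forall t, is_purification sigma (phi t)) /\
    (forall k, measurable_fun setT (fun t => complex.Re (phi t k)) /\
               measurable_fun setT (fun t => complex.Im (phi t k))) /\
    le_op (proj_op psi)
      (fun t t' => (g_dim n (dA * dR))%:R *
                   cintegral P (fun x => tens_pow_op (n:=n) (proj_op (phi x)) t t')).
Proof.
pose s : 'M[R[i]]_dA := \matrix_(i, j) sigma i j.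
pose Psi : 'M[R[i]]_(#|{: n.-tuple 'I_dA}|, #|{: n.-tuple 'I_dR}|) :=
  \matrix_(i, j) psi (zip_idx (enum_val i) (enum_val j)).
have psd_s : psdmx s.
  (* [psd_op] conjugates its left argument and [psdmx] its right one, so the test vector is
     conjugated. *)
  move=> v; have := Hsigma (fun i => (v 0 i)^*); congr (0 <= _).
  rewrite exchange_big mxE; apply: eq_bigr => j _; rewrite !mxE mulr_suml.
  by apply: eq_bigr => i _; rewrite !mxE conjCK.
have PsiPsi : Psi *m Psi ^t* = tens_pow_mx n s.
  apply/matrixP => i i'; rewrite !mxE.
  transitivity (tens_pow_op (n := n) sigma (enum_val i) (enum_val i')); last first.
    by apply: eq_bigr => k _; rewrite mxE.
  rewrite -Hpur /ptrace_Rn.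
  rewrite [RHS](reindex (@enum_val _ {: n.-tuple 'I_dR}));
    last exact/onW_bij/enum_val_bij.
  by apply: eq_bigr => j _; rewrite !mxE.
have [Phi PhiE] := purification_exists psd_s PsiPsi hn.
have [M [XW XWW]] := purification_intertwiner psd_s PsiPsi PhiE.
set W := tens_pow_mx n M *m Psi in XW XWW.
have [N [w [U [w0 w1 uU inv]]]] := invariant_frame (tens_pow_mx n Phi).
have [P intP] := finite_probability_exists w0 w1.
(* Outside ['I_N] the default is the identity, because [phi t] has to be a purification for every
   [t]. *)
pose Ut (t : nat) : 'M[R[i]]_dR := if insub t is Some k then U k else 1%:M.
have UtE (k : 'I_N) : Ut k = U k by rewrite /Ut valK.
have uUt t : Ut t \is unitarymx.
  rewrite /Ut; case: insub => [k|]; first exact: uU.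
  by apply/unitarymxP; rewrite trmx1 map_mx1 mulmx1.
pose phi t (x : 'I_dA * 'I_dR) := (Phi *m Ut t) x.1 x.2.
exists _, nat, P, phi; split; last split=> [k|]; first 2 last.
- move=> v; set g := g_dim _ _.
  pose h (k : 'I_N) (t : n.-tuple ('I_dA * 'I_dR)) := \prod_(l < n) phi k (tnth t l).
  have cintE t t' : cintegral P (fun x => tens_pow_op (n:=n) (proj_op (phi x)) t t')
      = \sum_k (w k)%:C%C * proj_op (h k) t t'.
    apply: cpart_inj => b; rewrite cpart_sum.
    under [RHS]eq_bigr do rewrite cpartZ -tens_pow_proj_op.
    by case: b; rewrite /= intP.
  pose X k := tens_pow_mx n Phi *m tens_pow_mx n (U k).
  have XE : X = fun k => \matrix_(i, j) h k (zip_idx (enum_val i) (enum_val j)).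
    apply/funext => k; rewrite /X -tens_pow_mxM; apply/matrixP => i j; rewrite !mxE.
    by apply: eq_bigr => l _; rewrite tnth_mktuple /phi UtE.
  pose Y : 'M[R[i]]_(#|{: n.-tuple 'I_dA}|, #|{: n.-tuple 'I_dR}|) :=
    \matrix_(i, j) v (zip_idx (enum_val i) (enum_val j)).
  have frobY (x : n.-tuple ('I_dA * 'I_dR) -> R[i]) :
      frob (\matrix_(i, j) x (zip_idx (enum_val i) (enum_val j))) Y =
      \sum_t x t * (v t)^*.
    rewrite frobE sum_zip_idx; apply: eq_bigr => i _; apply: eq_bigr => j _.
    by rewrite !mxE.
  have -> : \sum_i \sum_j (v i)^* * (g%:R *
        cintegral P (fun x => tens_pow_op (n:=n) (proj_op (phi x)) i j) -
        proj_op psi i j) * v j =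
      g%:R * \sum_k (w k)%:C%C * `|frob (X k) Y| ^+ 2 - `|frob Psi Y| ^+ 2.
    rewrite frobY -proj_op_form XE.
    under [in RHS]eq_bigr do rewrite frobY -proj_op_form mulr_sumr.
    rewrite [X in g%:R * X - _]exchange_big mulr_sumr -sumrB.
    apply: eq_bigr => t _ /=.
    under [in RHS]eq_bigr do rewrite mulr_sumr.
    rewrite [X in g%:R * X - _]exchange_big mulr_sumr -sumrB.
    apply: eq_bigr => t' _ /=.
    rewrite cintE mulrBr mulrBl; congr (_ - _).
    rewrite !mulr_sumr mulr_suml; apply: eq_bigr => k _; ring.
  rewrite subr_ge0 -XW.
  pose wC k := (w k)%:C%C : R[i].
  pose F := frame_op wC X : {linear _ -> _}.
  apply: (@frame_bound _ _ _ _ wC X _ _ (fun k => tens_pow_mx n (U k))) => //.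
  + by move=> k; rewrite lecR.
  + by rewrite -rmorph_sum w1.
  + by move=> k; exact: tens_pow_mx_unitary.
  + by move=> k Z; exact: inv.
  (* [Wf] is the kernel of [W]. Permuting the summation tuple [a] together with [r] and [r'] leaves
     both the tensor power of [M] and [psi] unchanged. *)
  + pose Wf (r r' : n.-tuple 'I_dR) := \sum_(a : n.-tuple 'I_dA)
      (\prod_(k < n) M (tnth r k) (tnth a k)) * psi (zip_idx a r').
    have -> : W = \matrix_(i, j) Wf (enum_val i) (enum_val j).
      apply/matrixP => i j; rewrite !mxE /Wf.
      rewrite [RHS](reindex (@enum_val _ {: n.-tuple 'I_dA}));
    last exact/onW_bij/enum_val_bij.
      by apply: eq_bigr => l _; rewrite !mxE.
    apply: (@comm_right_symmetric _ _ _ _ F) => [V uV Z|p r r']; first exact: inv.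
    rewrite /Wf (reindex (@permute_tuple n 'I_dA p)) /=.
      apply: eq_bigr => a _; rewrite -permute_zip_idx Hsym; congr (_ * _).
      rewrite [RHS](reindex_inj (@perm_inj _ p)) /=.
      by apply: eq_bigr => k _; rewrite !tnth_mktuple.
    exists (@permute_tuple n 'I_dA p^-1%g) => a _; apply/eq_from_tnth => k;
      by rewrite !tnth_mktuple ?permK ?permKV.
  (* Each [h k] is a product of one function over all positions, hence symmetric. *)
  + rewrite XE; apply: rank_synthesis_le => // k p t; rewrite /h.
    rewrite [RHS](reindex_inj (@perm_inj _ p)) /=.
    by apply: eq_bigr => l _; rewrite tnth_mktuple.
- move=> t a a'; rewrite /ptrace_R /proj_op /phi /=.
  have /matrixP/(_ a a') : (Phi *m Ut t) *m (Phi *m Ut t) ^t* = s.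
    by rewrite adjM mulmxA mulmxtVK.
  by rewrite [X in _ = X -> _]mxE mxE => <-; apply: eq_bigr => r _; rewrite !mxE.
- by split.
Qed.
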